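(* Assume that $|\chi|=\infty$. Let $M\in\mathcal{W}$ be finite dimensional and indecomposable. Then $M$ is isomorphic to some $V_t(\lambda)$, where $t\geq 1$ and $\lambda\in\widehat{G}$. Moreover, $\{V_t(\lambda)\mid t\geq 1,\lambda\in\widehat{G}\}$ is a representative set of isomorphism classes of finite dimensional indecomposable objects in $\mathcal{W}$.
   Context: $k$ is a field, $G$ a group, $\widehat{G}$ the group of characters $G\to k^{\times}$, $\chi\in\widehat{G}$ of order $|\chi|$ (possibly $\infty$), and $a\in Z(G)$ with $\chi(a)\neq 1$. $H=kG(\chi^{-1},a,0)$ is the Hopf algebra generated as an algebra by $G$ and $x$ with relations $xg=\chi^{-1}(g)gx$ ($g\in G$), having $k$-basis $\{gx^i\mid g\in G,i\geq 0\}$, with $\Delta(x)=x\otimes a+1\otimes x$, $\varepsilon(x)=0$, $S(x)=-xa^{-1}$, and each $g\in G$ group-like. For an $H$-module $M$ and $\lambda\in\widehat{G}$, $M_{(\lambda)}=\{v\in M\mid g\cdot v=\lambda(g)v\ \forall g\in G\}$. $M$ is a weight module if $M=\bigoplus_{\lambda\in\widehat{G}}M_{(\lambda)}$; $\mathcal{W}$ is the full subcategory of left $H$-modules consisting of all weight modules. For $t\geq 1$ and $\lambda\in\widehat{G}$, $V_t(\lambda)$ is the $t$-dimensional $H$-module with $k$-basis $m_0,\dots,m_{t-1}$ and action $g\cdot m_i=\chi^i(g)\lambda(g)m_i$; $x\cdot m_i=m_{i+1}$ for $0\leq i\leq t-2$; $x\cdot m_{t-1}=0$. *)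

(* Defs.v *)
From HB Require Import structures.
From mathcomp Require Import all_boot all_algebra.
From mathcomp Require Import finmap.
From mathcomp Require Import boolp.
From mathcomp.multinomials Require Import monalg.

Set Implicit Arguments.
Unset Strict Implicit.
Unset Printing Implicit Defensive.
Import GRing.Theory.
Local Open Scope ring_scope.

Section Characters.
Variables (k : fieldType) (G : groupType).

Record char_group := CharGroup {
  char_val :> G -> k;
  char_neq0 : forall g, char_val g != 0;
  charM : forall g h, char_val (g * h)%g = char_val g * char_val h }.

Lemma char_eqP (l m : char_group) : (forall g, l g = m g) -> l = m.
Proof.
case: l m => [l l0 lM] [m m0 mM] /= /funext E; subst m.
by congr CharGroup; apply: Prop_irrelevance.
Qed.

HB.instance Definition _ := gen_eqMixin char_group.
HB.instance Definition _ := gen_choiceMixin char_group.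

Lemma char1 (l : char_group) : l 1%g = 1.
Proof.
by apply: (mulfI (char_neq0 l 1%g)); rewrite -charM mulg1 mulr1.
Qed.

Definition char_one : char_group.
Proof.
by exists (fun=> 1) => [g|g h]; rewrite ?oner_neq0 ?mulr1.
Defined.

Definition char_mul (l m : char_group) : char_group.
Proof.
exists (fun g => l g * m g) => [g|g h]; first by rewrite mulf_neq0 ?char_neq0.
by rewrite !charM mulrACA.
Defined.

Definition char_inv (l : char_group) : char_group.
Proof.
exists (fun g => (l g)^-1) => [g|g h]; first by rewrite invr_neq0 ?char_neq0.
by rewrite charM invfM.
Defined.

Fact char_mulA : associative char_mul.
Proof. by move=> l m n; apply: char_eqP => g /=; rewrite mulrA. Qed.

Fact char_mul1 : left_id char_one char_mul.
Proof. by move=> l; apply: char_eqP => g /=; rewrite mul1r. Qed.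

Fact char_mulr1 : right_id char_one char_mul.
Proof. by move=> l; apply: char_eqP => g /=; rewrite mulr1. Qed.

Fact char_mulV : left_inverse char_one char_inv char_mul.
Proof. by move=> l; apply: char_eqP => g /=; rewrite mulVf ?char_neq0. Qed.

Fact char_mulrV : right_inverse char_one char_inv char_mul.
Proof. by move=> l; apply: char_eqP => g /=; rewrite mulfV ?char_neq0. Qed.

HB.instance Definition _ := isGroup.Build char_group
  char_mulA char_mul1 char_mulr1 char_mulV char_mulrV.

Definition infinite_order (chi : char_group) : Prop :=
  forall n, (0 < n)%N -> (chi ^+ n)%g <> 1%g.

End Characters.

Section LinearExtension.
Variables (k : fieldType) (K : choiceType) (V : lmodType k) (phi : K -> V).
Local Open Scope fset_scope.

Definition mlin (f : {malg k[K]}) : V := \sum_(u <- msupp f) f@_u *: phi u.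

Lemma mlinE f : mlin f = \sum_(u <- msupp f) f@_u *: phi u. Proof. by []. Qed.

Lemma mlinEw (d : {fset K}) f : msupp f `<=` d ->
  mlin f = \sum_(u <- d) f@_u *: phi u.
Proof.
move=> le_d; apply: big_fset_incl => // u _ /mcoeff_outdom ->.
by rewrite scale0r.
Qed.

Fact mlin_is_linear : linear mlin.
Proof.
move=> c f h; pose d := msupp f `|` msupp h.
have lef : msupp f `<=` d by apply: fsubsetUl.
have leh : msupp h `<=` d by apply: fsubsetUr.
have lefh : msupp (c *: f + h) `<=` d.
  apply: fsubset_trans (msuppD_le _ _) _; apply: fsetSU.
  exact: msuppZ_le.
rewrite (mlinEw lef) (mlinEw leh) (mlinEw lefh) scaler_sumr -big_split /=.
by apply: eq_bigr => u _; rewrite mcoeffD mcoeffZ scalerDl scalerA.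
Qed.

HB.instance Definition _ :=
  GRing.isLinear.Build k {malg k[K]} V *:%R mlin mlin_is_linear.

Lemma mlinU c u : mlin << c *g u >> = c *: phi u.
Proof. by rewrite (mlinEw msuppU_le) big_seq_fset1 mcoeffUU. Qed.

End LinearExtension.

Section LinearExtensionTheory.
Variables (k : fieldType) (K : choiceType).

Lemma malgUZ (c : k) u : << c *g u >> = c *: << u >> :> {malg k[K]}.
Proof. by apply/malgP => w; rewrite mcoeffZ !mcoeffU mulrnAr mulr1. Qed.

Lemma malg_lin_eq (V : lmodType k) (F1 F2 : {malg k[K]} -> V) :
  linear F1 -> linear F2 -> (forall u, F1 << u >> = F2 << u >>) ->
  forall f, F1 f = F2 f.
Proof.
move=> L1 L2 E f.
have lin (F : {malg k[K]} -> V) (L : linear F) :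
    exists G : {linear {malg k[K]} -> V}, F = G.
  pose G : {linear {malg k[K]} -> V} :=
    HB.pack F (GRing.isLinear.Build _ _ _ _ F L).
  by exists G.
have [G1 E1] := lin _ L1; have [G2 E2] := lin _ L2.
rewrite {}E1 {}E2 in E *; rewrite (monalgE f) !linear_sum.
by apply: eq_bigr => u _; rewrite malgUZ !linearZ /= E.
Qed.

End LinearExtensionTheory.

(** The algebra underlying kG(eta, a, 0): k<G, x> with x g = eta(g) g x, where
    the basis element [<< (g, i) >>] stands for g x^i (see [Hx_Hg], [Hg_HxX]).
    The element a occurs only in the comultiplication and the antipode, so
    modules, weights and isomorphisms do not depend on it. *)
Definition kGx (k : fieldType) (G : groupType) (eta : char_group k G) : Type :=
  {malg k[(G * nat)%type]}.

Section Algebra.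
Variables (k : fieldType) (G : groupType) (eta : char_group k G).
Notation H := (kGx eta).
Notation A := {malg k[(G * nat)%type]}.

HB.instance Definition _ := GRing.Lmodule.copy H A.

(** (g x^i)(h x^j) = eta(h)^i gh x^(i+j), which is what x g = eta(g) g x forces *)
Definition kGx_mulU (u v : G * nat) : A :=
  << eta v.1 ^+ u.2 *g ((u.1 * v.1)%g, (u.2 + v.2)%N) >>.

Definition kGx_mul (f h : A) : A := mlin (fun u => mlin (kGx_mulU u) h) f.

Definition kGx_one : A := << (1%g, 0%N) >>.

Fact kGx_mulDl : left_distributive kGx_mul +%R.
Proof. by move=> f1 f2 h; apply: raddfD. Qed.

Fact kGx_mulDr : right_distributive kGx_mul +%R.
Proof.
move=> f h1 h2; rewrite /kGx_mul !(mlinE _ f) -big_split; apply: eq_bigr => u _ /=.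
by rewrite raddfD scalerDr.
Qed.

Fact kGx_scaleAl c f h : c *: kGx_mul f h = kGx_mul (c *: f) h.
Proof. by rewrite /kGx_mul linearZ. Qed.

Fact kGx_scaleAr c f h : c *: kGx_mul f h = kGx_mul f (c *: h).
Proof.
rewrite /kGx_mul !(mlinE _ f) scaler_sumr; apply: eq_bigr => u _.
by rewrite [mlin _ (_ *: _)]linearZ /= !scalerA mulrC.
Qed.

Lemma kGx_mulUU u v : kGx_mul << u >> << v >> = kGx_mulU u v.
Proof. by rewrite /kGx_mul !mlinU !scale1r. Qed.

Fact kGx_mull_linear h : linear (kGx_mul ^~ h).
Proof. by move=> c f1 f2; rewrite kGx_mulDl kGx_scaleAl. Qed.
Fact kGx_mulr_linear f : linear (kGx_mul f).
Proof. by move=> c f1 f2; rewrite kGx_mulDr kGx_scaleAr. Qed.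

Fact kGx_mulA : associative kGx_mul.
Proof.
move=> f g h; move: f; apply: malg_lin_eq.
- exact: kGx_mull_linear.
- by move=> c f1 f2; rewrite !kGx_mull_linear.
move=> u; move: g; apply: malg_lin_eq.
- by move=> c f1 f2; rewrite kGx_mull_linear kGx_mulr_linear.
- by move=> c f1 f2; rewrite kGx_mulr_linear kGx_mull_linear.
move=> v; move: h; apply: malg_lin_eq.
- by move=> c f1 f2; rewrite !kGx_mulr_linear.
- exact: kGx_mulr_linear.
move=> w; rewrite !kGx_mulUU /kGx_mulU (malgUZ (_ ^+ v.2)) (malgUZ (_ ^+ u.2)).
rewrite -kGx_scaleAr -kGx_scaleAl !kGx_mulUU /kGx_mulU /=.
rewrite (malgUZ (_ ^+ _)) [in RHS]malgUZ !scalerA mulgA addnA; congr (_ *: _).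
by rewrite charM exprMn exprD mulrC mulrA.
Qed.

Fact kGx_mul1 : left_id kGx_one kGx_mul.
Proof.
apply: malg_lin_eq => // [|[g i]]; first exact: kGx_mulr_linear.
by rewrite kGx_mulUU /kGx_mulU /= expr0 mul1g.
Qed.

Fact kGx_mulr1 : right_id kGx_one kGx_mul.
Proof.
apply: (malg_lin_eq (F1 := kGx_mul ^~ kGx_one)) => // [|[g i]].
  exact: kGx_mull_linear.
by rewrite kGx_mulUU /kGx_mulU /= char1 expr1n mulg1 addn0.
Qed.

Fact kGx_one_neq0 : kGx_one != 0.
Proof. by rewrite monalgU_eq0 oner_neq0. Qed.

HB.instance Definition _ := GRing.Zmodule_isNzRing.Build H
  kGx_mulA kGx_mul1 kGx_mulr1 kGx_mulDl kGx_mulDr kGx_one_neq0.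
HB.instance Definition _ := GRing.Lmodule_isLalgebra.Build k H kGx_scaleAl.
HB.instance Definition _ := GRing.Lalgebra_isAlgebra.Build k H kGx_scaleAr.

Definition Hg (g : G) : H := << (g, 0%N) >>.
Definition Hx : H := << (1%g, 1%N) >>.

Lemma Hg1 : Hg 1%g = 1. Proof. by []. Qed.

Lemma HgM g h : Hg (g * h)%g = Hg g * Hg h.
Proof.
by rewrite [RHS]kGx_mulUU /kGx_mulU /= expr0.
Qed.

Lemma Hx_Hg g : Hx * Hg g = eta g *: (Hg g * Hx).
Proof.
rewrite [Hx * _]kGx_mulUU [Hg g * _]kGx_mulUU /kGx_mulU /=.
by rewrite expr1 expr0 mul1g mulg1 malgUZ.
Qed.

Lemma Hg_HxX g i : Hg g * Hx ^+ i = << (g, i) >> :> A.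
Proof.
elim: i => [|i IHi]; first by rewrite expr0 mulr1.
rewrite exprSr mulrA IHi [LHS]kGx_mulUU /kGx_mulU /=.
by rewrite char1 expr1n mulg1 addn1.
Qed.

End Algebra.

Section Modules.
Variables (k : fieldType) (G : groupType) (eta : char_group k G).
Notation H := (kGx eta).
Implicit Types (M N : lmodType H) (lam : char_group k G).

(** k acts on an H-module through its structure map [c |-> c%:A] into H. *)
Definition weight_space M lam (v : M) : Prop :=
  forall g, Hg eta g *: v = ((lam g)%:A : H) *: v.

(** The two clauses say that the weight spaces span M and are independent;
    together: M is their internal direct sum. *)
Definition weight_module M : Prop :=
  (forall v : M, exists (s : seq (char_group k G)) (w : char_group k G -> M),
     [/\ uniq s, forall lam, weight_space lam (w lam)
       & v = \sum_(lam <- s) w lam]) /\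
  (forall (s : seq (char_group k G)) (w : char_group k G -> M),
     uniq s -> (forall lam, weight_space lam (w lam)) ->
     \sum_(lam <- s) w lam = 0 -> forall lam, lam \in s -> w lam = 0).

Definition findim M : Prop :=
  exists (n : nat) (e : 'I_n -> M), forall v : M,
    exists c : 'I_n -> k, v = \sum_i ((c i)%:A : H) *: e i.

Definition indecomposable M : Prop :=
  (exists v : M, v <> 0) /\
  forall A B : {pred M}, GRing.submod_closed A -> GRing.submod_closed B ->
    (forall v : M, exists a b, [/\ a \in A, b \in B & v = a + b]) ->
    (forall v : M, v \in A -> v \in B -> v = 0) ->
    (forall v : M, v \in A -> v = 0) \/ (forall v : M, v \in B -> v = 0).

Definition isomorphic M N : Prop := exists f : {linear M -> N}, bijective f.

End Modules.

Definition Vmod (k : fieldType) (G : groupType) (chi : char_group k G)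
  (t : nat) (lam : char_group k G) : Type := 'rV[k]_t.

Section StandardModules.
Variables (k : fieldType) (G : groupType) (chi : char_group k G).
Variables (t : nat) (lam : char_group k G).
Notation H := (kGx (chi^-1)%g).
Notation Vt := (Vmod chi t lam).

HB.instance Definition _ := GRing.Zmodule.copy Vt 'rV[k]_t.

(** The basis vector m_i is [delta_mx 0 i]; matrices act on row vectors from
    the right, so [V_mx] reverses products. *)
Definition V_x : 'M[k]_t := \matrix_(i, j) (j == i.+1 :> nat)%:R.

Definition V_g (g : G) : 'M[k]_t := diag_mx (\row_(i < t) (chi g ^+ i * lam g)).

Definition V_mx (h : H) : 'M[k]_t := mlin (fun u => V_x ^+ u.2 *m V_g u.1) h.

Definition V_scale (h : H) (v : Vt) : Vt := (v : 'rV[k]_t) *m V_mx h.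

Lemma V_gM g h : V_g (g * h)%g = V_g g *m V_g h.
Proof.
rewrite /V_g mulmx_diag; congr diag_mx; apply/rowP => i.
by rewrite !mxE !charM exprMn mulrACA.
Qed.

Lemma V_g1 : V_g 1%g = 1%:M.
Proof.
rewrite /V_g -diag_const_mx; congr diag_mx; apply/rowP => i.
by rewrite !mxE !char1 expr1n mulr1.
Qed.

Lemma V_gx g : V_g g *m V_x = (chi^-1)%g g *: (V_x *m V_g g).
Proof.
apply/matrixP => i j; rewrite /V_g mul_diag_mx mul_mx_diag !mxE.
case: eqP => [->|_]; last by rewrite mul0r !mulr0.
by rewrite /= mulr1 mul1r exprS -!mulrA mulKf ?char_neq0.
Qed.

Lemma V_gxX g i :
  V_g g *m V_x ^+ i = (chi^-1)%g g ^+ i *: (V_x ^+ i *m V_g g).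
Proof.
elim: i => [|i IHi]; first by rewrite !expr0 scale1r mulmx1 mul1mx.
rewrite exprS -[V_x * _]/(V_x *m _) mulmxA V_gx -scalemxAl -mulmxA IHi.
by rewrite -scalemxAr scalerA -exprS mulmxA.
Qed.

Fact V_mx_linear : linear V_mx.
Proof. by move=> c f h; rewrite /V_mx linearP. Qed.

Lemma V_mxM (f h : H) : V_mx (f * h) = V_mx h *m V_mx f.
Proof.
move: f; apply: malg_lin_eq.
- by move=> c f1 f2; rewrite mulrDl -scalerAl V_mx_linear.
- by move=> c f1 f2; rewrite V_mx_linear mulmxDr scalemxAr.
move=> u; move: h; apply: malg_lin_eq.
- by move=> c f1 f2; rewrite mulrDr -scalerAr V_mx_linear.
- by move=> c f1 f2; rewrite V_mx_linear mulmxDl scalemxAl.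
move=> v.
rewrite [X in V_mx X]kGx_mulUU /kGx_mulU /V_mx !mlinU !scale1r.
rewrite -mulmxA [V_g v.1 *m _]mulmxA V_gxX -!scalemxAl -scalemxAr.
rewrite -!mulmxA -V_gM mulmxA addnC exprD; congr (_ *: (_ *m _)).
by rewrite !V_gM; apply: diag_mxC.
Qed.

Lemma V_mx1 : V_mx 1 = 1%:M.
Proof. by rewrite /V_mx mlinU /= V_g1 mulmx1 scale1r expr0. Qed.

Fact V_scaleA (f h : H) (v : Vt) : V_scale f (V_scale h v) = V_scale (f * h) v.
Proof. by rewrite /V_scale V_mxM mulmxA. Qed.

Fact V_scale1 : left_id 1 V_scale.
Proof. by move=> v; rewrite /V_scale V_mx1 mulmx1. Qed.

Fact V_scaleDr : right_distributive V_scale +%R.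
Proof. by move=> h v w; rewrite /V_scale mulmxDl. Qed.

Fact V_scaleDl (v : Vt) : {morph V_scale^~ v : f h / f + h}.
Proof. by move=> f h; rewrite /V_scale /V_mx raddfD mulmxDr. Qed.

HB.instance Definition _ := GRing.Zmodule_isLmodule.Build H Vt
  V_scaleA V_scale1 V_scaleDr V_scaleDl.

Definition V_basis (i : 'I_t) : Vt := delta_mx 0 i.

Lemma V_basis_coord (v : Vt) :
  v = \sum_i (((v : 'rV[k]_t) 0 i)%:A : H) *: V_basis i.
Proof.
rewrite [LHS](row_sum_delta (v : 'rV[k]_t)); apply: eq_bigr => i _.
by rewrite /GRing.scale /= /V_scale /V_mx linearZ /= -/(V_mx 1) V_mx1
           scalemx1 mul_mx_scalar.
Qed.

Lemma V_Hg g (i : 'I_t) :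
  Hg _ g *: V_basis i = ((chi g ^+ i * lam g)%:A : H) *: V_basis i.
Proof.
rewrite /GRing.scale /= /V_scale /V_mx linearZ /= -/(V_mx 1) V_mx1.
rewrite scalemx1 mul_mx_scalar mlinU scale1r /= expr0 mul1mx.
by rewrite -rowE row_diag_mx !mxE.
Qed.

Lemma V_Hx (i : 'I_t) (lt_it : (i.+1 < t)%N) :
  Hx _ *: V_basis i = V_basis (Ordinal lt_it).
Proof.
rewrite [LHS]/GRing.scale /= /V_scale /V_mx mlinU scale1r /= V_g1 mulmx1 expr1.
by rewrite -rowE; apply/rowP => j; rewrite !mxE -val_eqE.
Qed.

Lemma V_Hx_last (i : 'I_t) : i.+1 = t -> Hx _ *: V_basis i = 0.
Proof.
move=> it; rewrite [LHS]/GRing.scale /= /V_scale /V_mx mlinU scale1r /= V_g1.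
rewrite mulmx1 expr1 -rowE; apply/rowP => j; rewrite !mxE it.
by rewrite ltn_eqF.
Qed.

End StandardModules.

(* Main.v *)
From HB Require Import structures.
Require Import Defs.
From mathcomp Require Import all_boot all_algebra.
From mathcomp Require Import finmap boolp.
From mathcomp.multinomials Require Import monalg.

Set Implicit Arguments.
Unset Strict Implicit.
Unset Printing Implicit Defensive.
Import GRing.Theory.
Local Open Scope ring_scope.

(** The modules V_t(lambda) split off.  Let M be a finite dimensional weight
    module.  Since x moves the weight lambda to chi lambda, and the powers of
    chi are distinct while M has finitely many weights, x acts nilpotently on
    M ([weight_module_nilpotent]).  Let t be its nilpotency index, choose a
    weight vector v, of weight lambda, with w = x^(t-1) v <> 0, and a linear
    form f on M which takes the value 1 at w and satisfies
    f (g m) = (chi^(t-1) lambda)(g) f(m).  Then there are two H-linear maps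
    - psi : V_t(lambda) -> M, sending m_i to x^i v ([V_lift]),
    - phi : M -> V_t(lambda), whose i-th coordinate at m is f (x^(t-1-i) m)
      ([V_colift]).
    The form f vanishes on all weight spaces but that of w, and
    v, x v, ..., x^(t-1) v have pairwise distinct weights, so
    phi (psi m_0) = m_0; as m_0 generates V_t(lambda), phi psi = id.  Hence
    M is the direct sum of im psi and ker phi, and if M is indecomposable then
    ker phi = 0 and phi is an isomorphism ([indecomposable_retract]).
    The weight vectors and linear forms come from a basis of weight vectors and
    its coordinate functions ([weight_coordinates]).

    Conversely V_t(lambda) is indecomposable because its nonzero submodules all
    contain m_(t-1) ([V_submod_socle]), so that two of them cannot be in direct
    sum.  Finally t and lambda are invariants of V_t(lambda): t is the
    nilpotency index of x, and chi^(t-1) lambda is the weight of the image of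
    x^(t-1), which is the line spanned by m_(t-1). *)

(** * Characters *)

Section CharacterPowers.
Variables (k : fieldType) (G : groupType).
Implicit Types (chi lam : char_group k G).

Lemma charME chi lam g : (chi * lam)%g g = chi g * lam g.
Proof. by []. Qed.

Lemma charXE chi n g : (chi ^+ n)%g g = chi g ^+ n.
Proof.
elim: n => [//|n IHn].
by rewrite expgS charME IHn exprS.
Qed.

Lemma char_shift_inj chi lam i j : infinite_order chi ->
  (chi ^+ i * lam = chi ^+ j * lam)%g -> i = j.
Proof.
move=> chi_inf /mulIg.
wlog le_ij : i j / (i <= j)%N.
  by move=> W; case/orP: (leq_total i j) => le E; [|symmetry]; apply: W.
rewrite -{1}(subnK le_ij) expgnDr -{1}[(chi ^+ i)%g]mul1g => /mulIg E.
apply/eqP; rewrite eqn_leq le_ij leqNgt -subn_gt0.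
by apply/negP => /chi_inf[].
Qed.

End CharacterPowers.

(** * Modules over H and bases of weight vectors *)

Section ModulesOverH.
Variables (k : fieldType) (G : groupType) (eta : char_group k G).
Notation H := (kGx eta).
Implicit Types (M N : lmodType H) (h : H) (c : k) (lam mu : char_group k G).

(** The scalars c of k act on an H-module through the elements c 1 of H; this
    and the next lemmas say that H-modules are in particular k-vector spaces on
    which H acts k-linearly. *)
Lemma algZC M h c (v : M) : h *: (c%:A *: v) = (c%:A : H) *: (h *: v).
Proof. by rewrite !scalerA mulr_algr mulr_algl. Qed.

Lemma algZl M c h (v : M) : (c *: h) *: v = (c%:A : H) *: (h *: v).
Proof. by rewrite scalerA mulr_algl. Qed.

Lemma algZA M c d (v : M) :
  (c%:A : H) *: ((d%:A : H) *: v) = ((c * d)%:A : H) *: v.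
Proof. by rewrite !scalerA mulr_algl scalerA. Qed.

Lemma algZDl M c d (v : M) :
  ((c + d)%:A : H) *: v = (c%:A : H) *: v + (d%:A : H) *: v.
Proof. by rewrite !scalerDl. Qed.

(** The elements g x^i span H over k. *)
Lemma kGx_generators (M N : lmodType H) (phi : M -> N) :
  {morph phi : u v / u + v} ->
  (forall c v, phi ((c%:A : H) *: v) = (c%:A : H) *: phi v) ->
  (forall g v, phi (Hg eta g *: v) = Hg eta g *: phi v) ->
  (forall v, phi (Hx eta *: v) = Hx eta *: phi v) ->
  exists f : {linear M -> N}, f =1 phi.
Proof.
move=> phiD phiZ phig phix.
have phi0 : phi 0 = 0 by apply: (addIr (phi 0)); rewrite -phiD !add0r.
have phiX i v : phi (Hx eta ^+ i *: v) = Hx eta ^+ i *: phi v.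
  elim: i v => [|i IHi] v; first by rewrite !scale1r.
  by rewrite !exprSr -!scalerA IHi phix.
have phiH h v : phi (h *: v) = h *: phi v.
  have -> : h = \sum_(u <- msupp h) (h@_u)%:A * (Hg eta u.1 * Hx eta ^+ u.2).
    rewrite {1}(monalgE h); apply: eq_bigr => -[g i] _.
    by rewrite Hg_HxX malgUZ mulr_algl.
  rewrite !scaler_suml (big_morph phi phiD phi0); apply: eq_bigr => u _.
  by rewrite -!scalerA phiZ phig phiX.
have phiL : linear phi by move=> h u v; rewrite phiD phiH.
pose f : {linear M -> N} :=
  HB.pack phi (GRing.isLinear.Build _ _ _ _ phi phiL).
by exists f.
Qed.

(** M is the direct sum of the image of psi and the kernel of phi. *)
Lemma indecomposable_retract M N (psi : {linear N -> M}) (phi : {linear M -> N}) :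
  indecomposable M -> cancel psi phi -> (exists v : N, v <> 0) -> bijective phi.
Proof.
move=> [_ indM] psiK [v0 v0_neq0].
pose A : {pred M} := [pred m | `[< exists v, m = psi v >]].
pose B : {pred M} := [pred m | phi m == 0].
have Asub : GRing.submod_closed A.
  split=> [|h _ _ /asboolP[u ->] /asboolP[v ->]].
    by apply/asboolP; exists 0; rewrite linear0.
  by apply/asboolP; exists (h *: u + v); rewrite linearP.
have Bsub : GRing.submod_closed B.
  split=> [|h u v /eqP uB /eqP vB]; rewrite !inE ?linear0 //.
  by rewrite linearP uB vB scaler0 addr0.
have AB m : exists a b, [/\ a \in A, b \in B & m = a + b].
  exists (psi (phi m)), (m - psi (phi m)); split.
  - by apply/asboolP; exists (phi m).
  - by rewrite inE linearB psiK subrr.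
  - by rewrite addrC subrK.
have AIB m : m \in A -> m \in B -> m = 0.
  by move=> /asboolP[v ->]; rewrite inE psiK => /eqP->; rewrite linear0.
case: (indM A B Asub Bsub AB AIB) => [A0|B0].
  case: v0_neq0; rewrite -[v0]psiK (A0 (psi v0)) ?linear0 //.
  by apply/asboolP; exists v0.
exists psi => // m; apply/eqP; rewrite eq_sym -subr_eq0; apply/eqP; apply: B0.
by rewrite inE linearB psiK subrr.
Qed.

Definition spanning M (J : finType) (e : J -> M) (A : {set J}) : Prop :=
  forall v, exists c : J -> k, v = \sum_(j in A) ((c j)%:A : H) *: e j.

(** In a nontrivial linear relation, a vector with nonzero coefficient is a
    combination of the others, hence could be removed. *)
Lemma minimal_spanning_free M (J : finType) (e : J -> M) (A : {set J}) :
  spanning e A -> (forall B, spanning e B -> #|A| <= #|B|)%N ->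
  forall d : J -> k, \sum_(j in A) ((d j)%:A : H) *: e j = 0 ->
  forall j, j \in A -> d j = 0.
Proof.
move=> spanA minA d d0 j jA; apply/eqP/negPn/negP => dj.
have /minA : spanning e (A :\ j).
  move=> v; have [c ->] := spanA v.
  (* the multiple of the relation d that cancels the coefficient of [e j] *)
  exists (fun i => c i - c j / d j * d i).
  transitivity (\sum_(i in A) ((c i)%:A : H) *: e i
      - ((c j / d j)%:A : H) *: \sum_(i in A) ((d i)%:A : H) *: e i).
    by rewrite d0 scaler0 subr0.
  rewrite scaler_sumr -sumrB (bigD1 j) //= algZA divfK // subrr add0r.
  apply: eq_big => [i|i _]; first by rewrite !inE andbC.
  by rewrite algZA !scalerBl.
by rewrite (cardsD1 j A) jA ltnn.
Qed.

(** The weight components of the members of a finite spanning family form a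
    finite spanning family of weight vectors; a minimal spanning subfamily of it
    is free. *)
Lemma weight_basis M : weight_module M -> findim M ->
  exists (n : nat) (e : 'I_n -> M) (wt : 'I_n -> char_group k G)
         (c : 'I_n -> M -> k),
    [/\ forall i, weight_space (wt i) (e i),
        forall v, v = \sum_i ((c i v)%:A : H) *: e i
      & forall d : 'I_n -> k, \sum_i ((d i)%:A : H) *: e i = 0 ->
          forall i, d i = 0].
Proof.
move=> [sumM _] [n [e espan]].
have /choice[s] : forall i, exists s : seq (char_group k G),
    exists w : char_group k G -> M,
    [/\ uniq s, forall lam, weight_space lam (w lam)
      & e i = \sum_(lam <- s) w lam] by move=> i; apply: sumM.
move=> /choice[w eE].
pose J : finType := {i : 'I_n & 'I_(size (s i))}.
pose wt (j : J) : char_group k G := nth 1%g (s (tag j)) (tagged j).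
pose f (j : J) : M := w (tag j) (wt j).
have fwt j : weight_space (wt j) (f j) by case: (eE (tag j)).
have spanT : spanning f [set: J].
  move=> v; have [c ->] := espan v.
  exists (fun j => c (tag j)).
  rewrite [RHS](eq_bigl xpredT) => [|j]; last by rewrite inE.
  rewrite -(sig_big_dep xpredT (fun _ => xpredT)
    (fun i (l : 'I_(size (s i))) =>
       ((c i)%:A : H) *: w i (nth 1%g (s i) l))) /=.
  apply: eq_bigr => i _; case: (eE i) => _ _ {1}->.
  by rewrite (big_nth 1%g) big_mkord scaler_sumr.
pose P (A : {set J}) := `[< spanning f A >].
have PT : P [set: J] by apply/asboolP.
case: (arg_minnP (fun A : {set J} => #|A|) PT) => A /asboolP spanA minA.
have freeA := minimal_spanning_free spanA
  (fun B sB => minA B (introT (asboolP _) sB)).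
have /choice[c cE] := spanA.
exists #|A|, (f \o enum_val), (wt \o enum_val), (fun i v => c v (enum_val i)).
split=> [i|v|d d0 i] /=; first exact: fwt.
  by rewrite {1}(cE v) big_enum_val.
(* d transported from the positions in A to J *)
pose d' j := \sum_(l | enum_val l == j) d l.
have d'E l : d' (enum_val l) = d l.
  by rewrite /d' (big_pred1 l) // => l'; rewrite (inj_eq enum_val_inj).
rewrite -d'E; apply: freeA; last exact: enum_valP.
by rewrite big_enum_val -[RHS]d0; apply: eq_bigr => l _; rewrite d'E.
Qed.

(** The coordinates in a basis of weight vectors are weight functionals: they
    stand in for the projections onto the weight spaces. *)
Lemma weight_coordinates M : weight_module M -> findim M ->
  exists (n : nat) (e : 'I_n -> M) (wt : 'I_n -> char_group k G)
         (c : 'I_n -> M -> k),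
    [/\ forall i, weight_space (wt i) (e i),
        forall v, v = \sum_i ((c i v)%:A : H) *: e i,
        forall i, {morph c i : u v / u + v},
        forall i b v, c i ((b%:A : H) *: v) = b * c i v
      & forall i g v, c i (Hg eta g *: v) = wt i g * c i v].
Proof.
move=> wM fM; have [n [e [wt [c [ewt cE efree]]]]] := weight_basis wM fM.
have cU v d : v = \sum_i ((d i)%:A : H) *: e i -> forall i, c i v = d i.
  move=> vE i; apply/eqP; rewrite -subr_eq0; apply/eqP.
  apply: (efree (fun i => c i v - d i)); rewrite -[RHS](subrr v).
  rewrite {3}vE {2}(cE v) -sumrB; apply: eq_bigr => j _.
  by rewrite !scalerBl.
exists n, e, wt, c; split=> // [i u v|i b v|i g v].
- apply: (cU _ (fun i => c i u + c i v)); rewrite {1}(cE u) {1}(cE v) -big_split.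
  by apply: eq_bigr => j _; rewrite algZDl.
- apply: (cU _ (fun i => b * c i v)); rewrite {1}(cE v) scaler_sumr.
  by apply: eq_bigr => j _; rewrite algZA.
- apply: (cU _ (fun i => wt i g * c i v)); rewrite {1}(cE v) scaler_sumr.
  by apply: eq_bigr => j _; rewrite algZC ewt algZA mulrC.
Qed.

Lemma coord_neq0 M (n : nat) (e : 'I_n -> M) (c : 'I_n -> M -> k) :
  (forall v, v = \sum_i ((c i v)%:A : H) *: e i) ->
  forall v, v <> 0 -> exists i, c i v <> 0.
Proof.
move=> cE v v_neq0; apply: contrapT => no_i; apply: v_neq0.
rewrite (cE v) big1 // => i _; suff -> : c i v = 0 by rewrite !scale0r.
by apply: contrapT => civ; apply: no_i; exists i.
Qed.

(** Evaluating [f (g v)] in two ways gives [mu g * f v = lam g * f v]. *)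
Lemma weight_functional M lam mu (f : M -> k) v :
  (forall b u, f ((b%:A : H) *: u) = b * f u) ->
  (forall g u, f (Hg eta g *: u) = mu g * f u) ->
  weight_space lam v -> f v <> 0 -> mu = lam.
Proof.
move=> fZ fg vlam fv; apply: char_eqP => g; apply: (mulIf (introN eqP fv)).
by rewrite -fg vlam fZ.
Qed.

End ModulesOverH.

(** * The action of x on weight modules *)

Section WeightShift.
Variables (k : fieldType) (G : groupType) (chi : char_group k G).
Notation H := (kGx (chi^-1)%g).
Local Notation x := (Hx (chi^-1)%g).
Local Notation gr := (Hg (chi^-1)%g).
Implicit Types (M : lmodType H) (lam : char_group k G).

Lemma HgHxX g i : gr g * x ^+ i = chi g ^+ i *: (x ^+ i * gr g).
Proof.
have Hgx : gr g * x = chi g *: (x * gr g).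
  by rewrite Hx_Hg scalerA mulfV ?char_neq0 // scale1r.
elim: i => [|i IHi]; first by rewrite mulr1 mul1r scale1r.
by rewrite !exprSr mulrA IHi -scalerAl -[X in _ *: X = _]mulrA Hgx -scalerAr scalerA mulrA.
Qed.

Lemma weight_HxX M lam (v : M) i :
  weight_space lam v -> weight_space (chi ^+ i * lam)%g (x ^+ i *: v).
Proof.
move=> vlam g; rewrite scalerA HgHxX algZl -scalerA vlam algZC algZA.
by rewrite charME charXE.
Qed.

(** With n basis vectors there are at most n weights, whereas
    e_i, x e_i, ..., x^n e_i would be n+1 vectors of distinct weights if none
    of them were zero. *)
Lemma weight_module_nilpotent M : infinite_order chi ->
  weight_module M -> findim M -> exists n, forall v : M, x ^+ n *: v = 0.
Proof.
move=> chi_inf wM fM.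
have [n [e [wt [c [ewt cE _ cZ cg]]]]] := weight_coordinates wM fM.
exists n.
have xe i : x ^+ n *: e i = 0.
  apply: contrapT => xe_neq0.
  have supp (j : 'I_n.+1) : exists l, (chi ^+ j * wt i)%g = wt l.
    have xje : x ^+ j *: e i <> 0.
      move=> xje0; apply: xe_neq0.
      rewrite -(subnK (ltn_ord j : (j <= n)%N)) exprD -scalerA xje0.
      by rewrite scaler0.
    have [l cl] := coord_neq0 cE xje; exists l; symmetry.
    exact: weight_functional (cZ l) (cg l) (weight_HxX j (ewt i)) cl.
  have [l lE] := choice supp.
  have /leq_card : injective l.
    move=> j1 j2 E; apply/val_inj/(char_shift_inj (lam := wt i) chi_inf).
    by rewrite !lE E.
  by rewrite !card_ord ltnn.
move=> v; rewrite (cE v) scaler_sumr big1 // => i _.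
by rewrite algZC xe scaler0.
Qed.

End WeightShift.

(** * The modules V_t(lambda) *)

Section StandardModuleTheory.
Variables (k : fieldType) (G : groupType) (chi : char_group k G).
Variables (t : nat) (lam : char_group k G).
Notation H := (kGx (chi^-1)%g).
Local Notation x := (Hx (chi^-1)%g).
Local Notation gr := (Hg (chi^-1)%g).
Notation Vt := (Vmod chi t lam).
Implicit Types (u v : Vt) (c : k) (i j : 'I_t).

Definition V_coord (v : Vt) (i : 'I_t) : k := (v : 'rV[k]_t) 0 i.

(** The basis vectors m_n, extended by m_n = 0 for n >= t, so that
    x m_n = m_(n+1) holds without a side condition. *)
Definition V_vec (n : nat) : Vt := (\row_j (j == n :> nat)%:R : 'rV[k]_t).

Lemma V_coordP u v : V_coord u =1 V_coord v -> u = v.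
Proof. by move=> E; apply/rowP. Qed.

Lemma V_coordD u v i : V_coord (u + v) i = V_coord u i + V_coord v i.
Proof. exact: mxE. Qed.

Lemma V_coord0 i : V_coord 0 i = 0.
Proof. exact: mxE. Qed.

Lemma V_coord_sum (I : Type) (r : seq I) (P : pred I) (F : I -> Vt) i :
  V_coord (\sum_(l <- r | P l) F l) i = \sum_(l <- r | P l) V_coord (F l) i.
Proof.
by apply: (big_morph (V_coord^~ i)) => [u v|]; rewrite ?V_coordD ?V_coord0.
Qed.

Lemma V_vecE n i : V_coord (V_vec n) i = (i == n :> nat)%:R.
Proof. exact: mxE. Qed.

Lemma V_vec_ord i : V_vec i = V_basis chi lam i.
Proof. by apply/rowP => j; rewrite !mxE. Qed.

Lemma V_vec_out n : (t <= n)%N -> V_vec n = 0.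
Proof.
move=> le_tn; apply: V_coordP => j; rewrite V_vecE V_coord0.
by rewrite ltn_eqF // (leq_trans _ le_tn).
Qed.

Lemma V_vec_neq0 i : V_vec i <> 0.
Proof.
move/(congr1 (V_coord^~ i))/eqP; rewrite /= V_vecE V_coord0 eqxx.
by rewrite oner_eq0.
Qed.

Lemma V_vec_decomp v : v = \sum_i ((V_coord v i)%:A : H) *: V_vec i.
Proof.
by rewrite {1}(V_basis_coord v); apply: eq_bigr => i _; rewrite V_vec_ord.
Qed.

Lemma V_coord_alg c v i : V_coord ((c%:A : H) *: v) i = c * V_coord v i.
Proof.
have mxA : V_mx t lam (c%:A : H) = c *: 1%:M.
  by rewrite -(V_mx1 chi t lam) /V_mx linearZ.
rewrite /V_coord [_ *: v]/GRing.scale /= /V_scale mxA.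
by rewrite scalemx1 mul_mx_scalar mxE.
Qed.

Lemma V_coord_Hg g v i : V_coord (gr g *: v) i = (chi ^+ i * lam)%g g * V_coord v i.
Proof.
rewrite [in LHS](V_vec_decomp v) scaler_sumr V_coord_sum (bigD1 i) //= big1 => [|j ji].
  rewrite addr0 algZC V_coord_alg V_vec_ord V_Hg V_coord_alg -V_vec_ord V_vecE.
  by rewrite eqxx mulr1 mulrC charXE.
rewrite algZC V_coord_alg V_vec_ord V_Hg V_coord_alg -V_vec_ord V_vecE.
by rewrite eq_sym -val_eqE in ji; rewrite (negPf ji) !mulr0.
Qed.

Lemma Hx_V_vec n : x *: V_vec n = V_vec n.+1.
Proof.
case: (ltnP n t) => [lt_nt|le_tn]; last first.
  by rewrite !V_vec_out ?scaler0 // leqW.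
rewrite (V_vec_ord (Ordinal lt_nt)); case: (ltnP n.+1 t) => [lt1|le1].
  by rewrite (V_Hx _ _ (i := Ordinal lt_nt) lt1) -V_vec_ord.
rewrite V_Hx_last ?V_vec_out //=.
by apply/eqP; rewrite eqn_leq lt_nt.
Qed.

Lemma HxX_V_vec m n : x ^+ m *: V_vec n = V_vec (n + m).
Proof.
elim: m => [|m IHm]; first by rewrite scale1r addn0.
by rewrite exprS -scalerA IHm Hx_V_vec addnS.
Qed.

Lemma V_coord_Hx0 v i : val i = 0%N -> V_coord (x *: v) i = 0.
Proof.
move=> i0; rewrite (V_vec_decomp v) scaler_sumr V_coord_sum big1 // => j _.
by rewrite algZC V_coord_alg Hx_V_vec V_vecE i0 mulr0.
Qed.

Lemma V_coord_HxS v i j : val i = j.+1 -> V_coord (x *: v) i = V_coord v j.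
Proof.
move=> ij; rewrite (V_vec_decomp v) scaler_sumr !V_coord_sum.
apply: eq_bigr => l _.
by rewrite algZC !V_coord_alg Hx_V_vec !V_vecE ij eqSS.
Qed.

Lemma V_vec_weight n : weight_space (chi ^+ n * lam)%g (V_vec n).
Proof.
move=> g; apply: V_coordP => i; rewrite V_coord_Hg V_coord_alg V_vecE.
by case: eqP => [->|_]; rewrite ?mulr0.
Qed.

Lemma V_weight_coord mu v i : weight_space mu v ->
  V_coord v i <> 0 -> (chi ^+ i * lam = mu)%g.
Proof.
move=> vmu; apply: (weight_functional (f := V_coord^~ i)) vmu => [b u|g u].
  exact: V_coord_alg.
exact: V_coord_Hg.
Qed.

Lemma V_findim : findim Vt.
Proof.
by exists t, (fun i => V_vec i) => v; exists (V_coord v); apply: V_vec_decomp.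
Qed.

Lemma V_weight_module : infinite_order chi -> weight_module Vt.
Proof.
move=> chi_inf; split=> [v|s w us ww sum0 mu mu_s].
  pose s := [seq (chi ^+ val i * lam)%g | i : 'I_t].
  exists s, (fun mu => \sum_(i < t | (chi ^+ i * lam)%g == mu)
    ((V_coord v i)%:A : H) *: V_vec i); split.
  - by rewrite map_inj_uniq ?enum_uniq // => i j /(char_shift_inj chi_inf)/val_inj.
  - move=> mu g; rewrite !scaler_sumr; apply: eq_bigr => i /eqP <-.
    by rewrite algZC V_vec_weight [RHS]algZC.
  - rewrite {1}(V_vec_decomp v) /s big_image /=; apply: eq_bigr => i _.
    rewrite (big_pred1 i) // => j; apply/eqP/eqP => [|-> //].
    by move/(char_shift_inj chi_inf)/val_inj.
apply: V_coordP => i; rewrite V_coord0; apply: contrapT => wi.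
apply: (wi); rewrite -[RHS](V_coord0 i) -sum0 V_coord_sum (bigD1_seq mu) //=.
rewrite big1 ?addr0 // => nu nu_mu; apply: contrapT => wnui.
case/eqP: nu_mu; rewrite -(V_weight_coord (ww nu) wnui).
exact: V_weight_coord (ww mu) wi.
Qed.

(** V_t(lambda) is the universal module generated by a vector of weight lambda
    killed by x^t. *)
Lemma V_lift (M : lmodType H) (v : M) : weight_space lam v -> x ^+ t *: v = 0 ->
  exists psi : {linear Vt -> M}, forall n, psi (V_vec n) = x ^+ n *: v.
Proof.
move=> vlam xtv.
have xv0 n : (t <= n)%N -> x ^+ n *: v = 0.
  by move=> /subnK <-; rewrite exprD -scalerA xtv scaler0.
pose psi (u : Vt) : M := \sum_i ((V_coord u i)%:A : H) *: (x ^+ i *: v).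
have psiD : {morph psi : u w / u + w}.
  move=> u w; rewrite -big_split; apply: eq_bigr => i _ /=.
  by rewrite V_coordD algZDl.
have psiZ c u : psi ((c%:A : H) *: u) = (c%:A : H) *: psi u.
  rewrite scaler_sumr; apply: eq_bigr => i _.
  by rewrite V_coord_alg algZA.
have psiE n : psi (V_vec n) = x ^+ n *: v.
  case: (ltnP n t) => [lt_nt|le_tn].
    rewrite /psi (bigD1 (Ordinal lt_nt)) //= V_vecE eqxx !scale1r.
    rewrite big1 ?addr0 // => i; rewrite -val_eqE /= V_vecE => /negPf->.
    by rewrite !scale0r.
  by rewrite xv0 // /psi big1 // => i _; rewrite V_vec_out // V_coord0 !scale0r.
have psi0 : psi 0 = 0 by rewrite /psi big1 // => i _; rewrite V_coord0 !scale0r.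
have psiH h : (forall n, psi (h *: V_vec n) = h *: psi (V_vec n)) ->
    forall u, psi (h *: u) = h *: psi u.
  move=> hvec u; rewrite [in LHS](V_vec_decomp u) scaler_sumr.
  rewrite (big_morph psi psiD psi0) {2}/psi scaler_sumr.
  by apply: eq_bigr => i _; rewrite algZC psiZ hvec psiE algZC.
have [g||f fE] := kGx_generators psiD psiZ.
- apply: psiH => n.
  by rewrite V_vec_weight psiZ psiE (weight_HxX _ vlam).
- by apply: psiH => n; rewrite Hx_V_vec !psiE exprS scalerA.
by exists f => n; rewrite fE psiE.
Qed.

(** Dually, V_t(lambda) is cofree: H-linear maps to it from a module killed by
    x^t correspond to their last coordinate, a form on which G acts through the
    weight chi^(t-1) lambda of m_(t-1); the other coordinates are forced by
    commutation with x. *)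
Lemma V_colift (M : lmodType H) (f : M -> k) :
  {morph f : u v / u + v} -> (forall c (v : M), f ((c%:A : H) *: v) = c * f v) ->
  (forall g (v : M), f (gr g *: v) = (chi ^+ t.-1 * lam)%g g * f v) ->
  (forall v : M, x ^+ t *: v = 0) ->
  exists phi : {linear M -> Vt}, forall (v : M) i,
    V_coord (phi v) i = f (x ^+ (t.-1 - i) *: v).
Proof.
move=> fD fZ fg xt0.
pose phi (v : M) : Vt := (\row_i f (x ^+ (t.-1 - i) *: v) : 'rV[k]_t).
have phiE (v : M) i : V_coord (phi v) i = f (x ^+ (t.-1 - i) *: v) by rewrite /V_coord mxE.
have f0 : f 0 = 0 by apply: (addIr (f 0)); rewrite -fD !add0r.
have [u v|c v|g v|v|psi psiE] := @kGx_generators _ _ _ M Vt phi.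
- by apply: V_coordP => i; rewrite V_coordD !phiE scalerDr fD.
- by apply: V_coordP => i; rewrite V_coord_alg !phiE algZC fZ.
- apply: V_coordP => i; rewrite V_coord_Hg !phiE.
  (* multiply by chi(g)^(t-1-i) to move g to the left of x^(t-1-i) *)
  apply: (mulfI (expf_neq0 (t.-1 - i) (char_neq0 chi g))).
  rewrite -[LHS]fZ [x ^+ _ *: (_ *: _)]scalerA -algZl -HgHxX -scalerA fg !charME !charXE.
  have le_it : (i <= t.-1)%N by rewrite -ltnS prednK // (leq_trans _ (ltn_ord i)).
  by rewrite -{1}(subnK le_it) exprD !mulrA.
- apply: V_coordP => i; rewrite phiE.
  have t_gt0 : (0 < t)%N by apply: leq_trans (ltn_ord i).
  case: i => -[|i] lt_it.
    rewrite V_coord_Hx0 // subn0 scalerA -exprSr prednK //.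
    by rewrite xt0.
  rewrite (V_coord_HxS _ (j := Ordinal (ltnW lt_it))) // phiE scalerA -exprSr.
  by rewrite [nat_of_ord _]/= subnSK // -ltnS prednK.
by exists psi => v i; rewrite psiE phiE.
Qed.

Lemma V_HxX_top v : exists c, x ^+ t.-1 *: v = (c%:A : H) *: V_vec t.-1.
Proof.
exists (\sum_(i | val i == 0%N) V_coord v i).
rewrite {1}(V_vec_decomp v) scaler_sumr.
rewrite (big_morph (fun c => (c%:A : H) *: V_vec t.-1)
  (fun c d => algZDl c d _) (id1 := 0)) ?scale0r //.
rewrite [RHS]big_mkcond /=.
apply: eq_bigr => i _; rewrite algZC HxX_V_vec.
case: eqP => [-> //|/eqP]; rewrite -lt0n => i_gt0.
rewrite V_vec_out ?scaler0 // -(prednK i_gt0) addSn.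
by rewrite (leq_trans (leqSpred t)) // ltnS leq_addl.
Qed.

Lemma V_HxX_nil v : x ^+ t *: v = 0.
Proof.
rewrite (V_vec_decomp v) scaler_sumr big1 // => i _.
by rewrite algZC HxX_V_vec V_vec_out ?scaler0 // leq_addl.
Qed.

(** If m_i is the first basis vector occurring in v, with coefficient c, then
    x^(t-1-i) v = c m_(t-1). *)
Lemma V_submod_socle (A : {pred Vt}) v : GRing.submod_closed A -> v \in A ->
  v <> 0 -> V_vec t.-1 \in A.
Proof.
move=> [A0 AL] vA v_neq0.
have Asc h u : u \in A -> h *: u \in A by move=> uA; rewrite -[_ *: _]addr0 AL.
have [i0 vi0] : exists i, V_coord v i != 0.
  apply: contrapT => no_i; apply: v_neq0; apply: V_coordP => i.
  by rewrite V_coord0; apply: contrapT => /eqP vi; apply: no_i; exists i.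
case: (@arg_minnP _ i0 (fun i => V_coord v i != 0) val vi0) => i vi mini.
suff -> : V_vec t.-1 = (((V_coord v i)^-1)%:A : H) *: (x ^+ (t.-1 - i) *: v).
  by rewrite !Asc.
have le_it : (i <= t.-1)%N by rewrite -ltnS prednK // (leq_trans _ (ltn_ord i)).
have := mulVf vi; move: (V_coord v i)^-1 => b bK.
rewrite [in RHS](V_vec_decomp v) !scaler_sumr (bigD1 i) //= big1 => [|j ji].
  by rewrite addr0 algZC algZA bK !scale1r HxX_V_vec subnKC.
case: (eqVneq (V_coord v j) 0) => [->|/mini le_ij]; first by rewrite !scale0r !scaler0.
rewrite algZC HxX_V_vec V_vec_out ?scaler0 //.
have lt_ij : (i < j)%N by rewrite ltn_neqAle le_ij eq_sym val_eqE ji.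
by apply: leq_trans (leqSpred t) _; rewrite -{1}(subnKC le_it) ltn_add2r.
Qed.

End StandardModuleTheory.

(** * Classification *)

Section Classification.
Variables (k : fieldType) (G : groupType) (chi : char_group k G).
Notation H := (kGx (chi^-1)%g).
Local Notation x := (Hx (chi^-1)%g).
Local Notation gr := (Hg (chi^-1)%g).

Lemma V_indecomposable t lam : (1 <= t)%N -> indecomposable (Vmod chi t lam).
Proof.
move=> t_gt0; split=> [|A B Asub Bsub _ AIB].
  by exists (V_vec chi t lam 0); exact: (@V_vec_neq0 _ _ chi t lam (Ordinal t_gt0)).
have t_lt : (t.-1 < t)%N by rewrite prednK.
apply: contrapT => /not_orP[/existsNP[u /not_implyP[uA u_neq0]]].
move=> /existsNP[v /not_implyP[vB v_neq0]].
apply: (@V_vec_neq0 _ _ chi t lam (Ordinal t_lt)).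
by apply: AIB; [apply: (V_submod_socle Asub uA)|apply: (V_submod_socle Bsub vB)].
Qed.

(** Any surjection V_t -> V_s transports the relation x^t = 0 to V_s, where it
    would fail at m_0 if t < s. *)
Lemma V_epi_le t s lam mu (f : {linear Vmod chi t lam -> Vmod chi s mu}) f' :
  cancel f' f -> (s <= t)%N.
Proof.
move=> f'K; rewrite leqNgt; apply/negP => lt_ts.
apply: (@V_vec_neq0 _ _ chi s mu (Ordinal lt_ts)) => /=.
by rewrite -[t]add0n -HxX_V_vec -[V_vec _ _ _ 0]f'K -linearZ /= V_HxX_nil linear0.
Qed.

(** f m_(t-1) = x^(t-1) f m_0 is a nonzero multiple of m_(t-1), and f preserves
    weights. *)
Lemma V_iso_inj t s lam mu : (1 <= t)%N ->
  isomorphic (Vmod chi t lam) (Vmod chi s mu) -> t = s /\ lam = mu.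
Proof.
move=> t_gt0 [f [f' fK f'K]].
have ts : t = s.
  have f'L : linear f'.
    by move=> h u v; apply: (can_inj fK); rewrite linearP !f'K.
  pose f'' : {linear Vmod chi s mu -> Vmod chi t lam} :=
    HB.pack f' (GRing.isLinear.Build _ _ _ _ f' f'L).
  apply/eqP; rewrite eqn_leq (V_epi_le f'K).
  by rewrite (@V_epi_le _ _ _ _ f'' f fK).
case: s / ts in f f' fK f'K *; split=> //.
have t_lt : (t.-1 < t)%N by rewrite prednK.
have ftop_wt : weight_space (chi ^+ t.-1 * lam)%g (f (V_vec chi t lam t.-1)).
  by move=> g; rewrite -linearZ /= V_vec_weight linearZ.
have ftop_neq0 : f (V_vec chi t lam t.-1) <> 0.
  move=> f0; apply: (@V_vec_neq0 _ _ chi t lam (Ordinal t_lt)).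
  by apply: (can_inj fK); rewrite linear0 -[RHS]f0.
have [c ftopE] := V_HxX_top (f (V_vec chi t lam 0)).
have topE : f (V_vec chi t lam t.-1) = (c%:A : H) *: V_vec chi t mu t.-1.
  by rewrite -ftopE -linearZ /= HxX_V_vec add0n.
have c_neq0 : V_coord (f (V_vec chi t lam t.-1)) (Ordinal t_lt) <> 0.
  move=> c0; apply: ftop_neq0; move: c0.
  by rewrite topE V_coord_alg V_vecE eqxx mulr1 => ->; rewrite !scale0r.
have /mulgI -> // := V_weight_coord ftop_wt c_neq0.
Qed.

(** The generator v of the split V_t(lambda) is a member [e i0] of a basis of
    weight vectors, and the form f is the coordinate at a basis vector that
    occurs in w = x^(t-1) v, normalised at w; such a basis vector has the weight
    of w. *)
Lemma indecomposable_iso_V (M : lmodType H) :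
  infinite_order chi ->
  weight_module M -> findim M -> indecomposable M ->
  exists (t : nat) (lam : char_group k G),
    (1 <= t)%N /\ isomorphic M (Vmod chi t lam).
Proof.
move=> chi_inf wM fM indM; have [[v0 v0_neq0] _] := indM.
have [n [e [wt [c [ewt cE cD cZ cg]]]]] := weight_coordinates wM fM.
have nilp : exists m, [forall i, x ^+ m *: e i == 0].
  have [m xm] := weight_module_nilpotent chi_inf wM fM.
  by exists m; apply/forallP => i; rewrite xm.
case: (ex_minnP nilp) => t /forallP xt mint.
have {}xt (v : M) : x ^+ t *: v = 0.
  by rewrite (cE v) scaler_sumr big1 // => i _; rewrite algZC (eqP (xt i)) scaler0.
have t_gt0 : (0 < t)%N.
  by rewrite lt0n; apply/eqP => t0; apply: v0_neq0; rewrite -(xt v0) t0 scale1r.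
have [i0 xe] : exists i, x ^+ t.-1 *: e i <> 0.
  apply: contrapT => no_i; have : (t <= t.-1)%N.
    apply: mint; apply/forallP => i; apply/eqP; apply: contrapT => xe.
    by apply: no_i; exists i.
  by rewrite -ltnS prednK // ltnn.
pose w := x ^+ t.-1 *: e i0.
have [l clw] : exists l, c l w <> 0 := coord_neq0 cE xe.
have c_wt mu (v : M) : weight_space mu v -> c l v <> 0 -> wt l = mu.
  exact: weight_functional (cZ l) (cg l).
have wtl : wt l = (chi ^+ t.-1 * wt i0)%g := c_wt _ _ (weight_HxX _ (ewt i0)) clw.
pose f v := c l v / c l w.
have fD : {morph f : u v / u + v} by move=> u v; rewrite /f cD mulrDl.
have fZ a v : f ((a%:A : H) *: v) = a * f v by rewrite /f cZ mulrA.
have fg g v : f (gr g *: v) = (chi ^+ t.-1 * wt i0)%g g * f v.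
  by rewrite /f cg wtl mulrA.
have [psi psiE] := V_lift (ewt i0) (xt (e i0)).
have [phi phiE] := V_colift fD fZ fg xt.
have phipsi0 : phi (psi (V_vec chi t (wt i0) 0)) = V_vec chi t (wt i0) 0.
  apply: V_coordP => i; rewrite phiE psiE scale1r V_vecE.
  have [i_eq0|i_gt0] := posnP i.
    by rewrite i_eq0 subn0 /f mulfV //; apply/eqP.
  rewrite /f.
  suff -> : c l (x ^+ (t.-1 - i) *: e i0) = 0 by rewrite mul0r.
  apply: contrapT => /(c_wt _ _ (weight_HxX _ (ewt i0))); rewrite wtl.
  (* distinct powers of chi: the form only sees the weight of w *)
  move/(char_shift_inj chi_inf)/esym/eqP; rewrite ltn_eqF // ltn_subrL i_gt0.
  by rewrite (leq_trans i_gt0) // -ltnS prednK.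
have psiK : cancel psi phi.
  move=> u; rewrite (V_vec_decomp u) !linear_sum; apply: eq_bigr => i _.
  rewrite !linearZ /= -[nat_of_ord i]add0n -HxX_V_vec !linearZ /=.
  by rewrite phipsi0.
exists t, (wt i0); split=> //; exists phi.
apply: (indecomposable_retract indM psiK).
by exists (V_vec chi t (wt i0) 0); exact: (@V_vec_neq0 _ _ chi t _ (Ordinal t_gt0)).
Qed.

End Classification.

Theorem corollary4p9 (k : fieldType) (G : groupType) (chi : char_group k G)
    (a : G) (a_central : forall g : G, commute a g) (chi_a : chi a <> 1%R)
    (chi_infinite : infinite_order chi) :
  (forall M : lmodType (kGx (chi^-1)%g),
     weight_module M -> findim M -> indecomposable M ->
     exists (t : nat) (lam : char_group k G),
       (1 <= t)%N /\ isomorphic M (Vmod chi t lam)) /\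
  (forall (t : nat) (lam : char_group k G), (1 <= t)%N ->
     [/\ weight_module (Vmod chi t lam), findim (Vmod chi t lam)
       & indecomposable (Vmod chi t lam)]) /\
  (forall (t s : nat) (lam mu : char_group k G), (1 <= t)%N -> (1 <= s)%N ->
     isomorphic (Vmod chi t lam) (Vmod chi s mu) -> t = s /\ lam = mu).
Proof.
split=> [M wM fM indM|]; first exact: indecomposable_iso_V.
split=> [t lam t_gt0|t s lam mu t_gt0 _]; last exact: V_iso_inj.
split; [exact: V_weight_module|exact: V_findim|exact: V_indecomposable].
Qed.
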